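(* Let $d\ge 2$. The skeleton of the dual Wythoffian $\alpha_d(\{0,d-1\})^\ast$ coincides with (is isomorphic to) the hypercube graph $H_{d+1}$ with two antipodal vertices removed. It is an isometric subgraph of $H_{d+1}$.
   Context: Complexes. A flag in a poset is a totally ordered subset. A connected poset $\mathcal{K}$ is an $n$-complex if every maximal flag has size $n+1$; each element (face) $x$ then has a dimension $\dim(x)\in\{0,\dots,n\}$, where minimal elements have dimension $0$ and $\dim(y)=\dim(x)+1$ whenever $y$ covers $x$. The dual complex $\mathcal{K}^\ast$ is $\mathcal{K}$ with the order reversed; it is an $n$-complex with $\dim^\ast(x)=n-\dim(x)$. An $n$-complex is a polytope if every flag of size $n$ is contained in exactly two maximal flags; then each $1$-face (edge) lies above exactly two $0$-faces (vertices). The skeleton of a polytope is the graph formed by its vertices and edges. Wythoff construction. Let $\mathcal{K}$ be an $n$-complex and $\Delta=\{0,\dots,n\}$. The type of a flag $F$ is $t(F)=\{\dim(x): x\in F\}\subseteq\Delta$. Fix a nonempty $V\subseteq\Delta$. For nonempty $U,U'\subseteq\Delta$ write $U'\le U$ if for all $u\in U$, $v\in V$ there is $u'\in U'$ with $u\le u'\le v$ or $u\ge u'\ge v$. This is a preorder; write $U\sim U'$ if $U\le U'$ and $U'\le U$, and $U'<U$ if $U'\le U$ but $U\not\le U'$. Each $\sim$-class $[U]$ has a unique smallest (under inclusion) member $m([U])$ and a unique largest member $M([U])$; the sets $m([U])$ are called essential. The Wythoffian $\mathcal{K}(V)$ is the poset of all flags $F$ of $\mathcal{K}$ whose type is essential,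 with $F'<F$ iff $t(F')<t(F)$ and $F\cup F'$ is a flag. It is again an $n$-complex, with $\dim(F)=n+1-|M([t(F)])|$, and is a polytope if $\mathcal{K}$ is. The simplex $\alpha_d$ is the $(d-1)$-complex whose faces are all proper nonempty subsets $X$ of $\{1,\dots,d+1\}$, ordered by inclusion, with $\dim X=|X|-1$. $\alpha_d(\{0,d-1\})^\ast$ denotes the dual of the Wythoffian $\alpha_d(\{0,d-1\})$. The hypercube graph $H_m$ has vertex set $\{0,1\}^m$, two vertices being adjacent when they differ in exactly one coordinate; two vertices are antipodal if they differ in all coordinates. A subgraph is isometric if distances measured in the subgraph equal those in the ambient graph. *)

(* Defs.v *)
From HB Require Import structures.
From mathcomp Require Import all_boot all_order.
From mathcomp Require Import zify.

Set Implicit Arguments.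
Unset Strict Implicit.
Unset Printing Implicit Defensive.

Import Order.TTheory.
Local Open Scope order_scope.

(** * Complexes *)

Section Complex.
Context {disp : Order.disp_t} (K : finPOrderType disp).
Implicit Types (F G : {set K}) (x y : K).

Definition flag F := [forall x in F, forall y in F, x >=< y].

Definition is_complex (n : nat) : Prop :=
  (forall x y, connect (fun a b : K => a >=< b) x y) /\
  (forall F, maxset flag F -> #|F| = n.+1).

(** The dimension is defined for every finite poset, as the largest size of a
    flag lying strictly below the element; [dim_minimal] and [dim_cover] below
    show that in a complex it is the dimension function. *)
Definition dim x : nat :=
  \max_(F : {set K} | flag F && [forall y in F, y < x]) #|F|.

(** All the indices of the type are kept only if the dimensions are at most
    [n], which holds in an [n]-complex, see [dim_le]. *)
Definition flag_type (n : nat) F : {set 'I_n.+1} :=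
  [set i : 'I_n.+1 | [exists x in F, dim x == i]].

Lemma flagP F : reflect {in F &, forall x y, x >=< y} (flag F).
Proof.
apply: (iffP forall_inP) => [h x y xF yF|h x xF].
  by have /forall_inP hx := h x xF; apply: hx.
by apply/forall_inP => y; apply: h.
Qed.

Lemma flag0 : flag set0.
Proof. by apply/flagP => x y; rewrite inE. Qed.

Lemma flagS F G : F \subset G -> flag G -> flag F.
Proof.
move=> /subsetP FG /flagP hG; apply/flagP => x y xF yF.
by apply: hG; apply: FG.
Qed.

Lemma flagU1 x F : flag F -> {in F, forall y, x >=< y} -> flag (x |: F).
Proof.
move=> /flagP hF hx; apply/flagP => y z; rewrite !inE.
move=> /orP[/eqP->|yF] /orP[/eqP->|zF]; rewrite ?comparablexx //;
  first exact: hx.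
  by rewrite comparable_sym; apply: hx.
exact: hF.
Qed.

Lemma flagU F G : flag F -> flag G -> {in F & G, forall x y, x >=< y} ->
  flag (F :|: G).
Proof.
move=> /flagP hF /flagP hG h; apply/flagP => x y; rewrite !inE.
move=> /orP[xF|xG] /orP[yF|yG]; [exact: hF|exact: h| |exact: hG].
by rewrite comparable_sym; apply: h.
Qed.

Lemma dim_ge x F : flag F -> {in F, forall y, y < x} -> (#|F| <= dim x)%N.
Proof.
move=> hF hx; apply: (@leq_bigmax_cond _ _ (fun F : {set K} => #|F|) F).
by rewrite hF; apply/forall_inP.
Qed.

Lemma dim_witness x :
  exists F, [/\ flag F, {in F, forall y, y < x} & #|F| = dim x].
Proof.
have h0 : flag set0 && [forall y in set0, y < x].
  by rewrite flag0; apply/forall_inP => y; rewrite inE.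
rewrite /dim; have [|F /andP[hF /forall_inP hx] ->] := @eq_bigmax_cond _
  (fun F : {set K} => flag F && [forall y in F, y < x]) (fun F => #|F|).
  by apply/card_gt0P; exists set0.
by exists F.
Qed.

Lemma dim_lt x y : x < y -> (dim x < dim y)%N.
Proof.
move=> xy; have [F [hF hx <-]] := dim_witness x.
have xF : x \notin F by apply/negP => /hx; rewrite ltxx.
have <- : #|x |: F| = #|F|.+1 by rewrite cardsU1 xF.
apply: dim_ge.
  by apply: flagU1 => // z /hx zx; rewrite comparable_sym; apply: lt_comparable.
by move=> z; rewrite !inE => /orP[/eqP->//|/hx zx]; apply: lt_trans xy.
Qed.

Lemma dim_minimal x : (forall y, ~~ (y < x)) -> dim x = 0%N.
Proof.
move=> hx; have [F [_ hF <-]] := dim_witness x.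
apply/eqP; rewrite cards_eq0; apply/eqP/setP => y; rewrite inE.
by apply/negP => /hF; apply/negP.
Qed.

Lemma dim_comparable x y : x >=< y -> (dim x <= dim y)%N -> x <= y.
Proof.
by case: comparableP => // yx _; rewrite leqNgt dim_lt.
Qed.

Lemma dim_le n x : is_complex n -> (dim x <= n)%N.
Proof.
move=> [_ hn]; have [F [hF hx <-]] := dim_witness x.
have hxF : flag (x |: F).
  by apply: flagU1 => // z /hx zx; rewrite comparable_sym; apply: lt_comparable.
have [G /hn cG sG] := maxset_exists hxF.
have xF : x \notin F by apply/negP => /hx; rewrite ltxx.
by move: (subset_leq_card sG); rewrite cG cardsU1 xF.
Qed.

Lemma maxset_flag F : flag F ->
  (forall z, {in F, forall y, z >=< y} -> z \in F) -> maxset flag F.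
Proof.
move=> hF h; apply/maxsetP; split=> // G hG FG.
apply/eqP; rewrite eqEsubset FG andbT; apply/subsetP => z zG.
by apply: h => y yF; apply: (flagP _ hG) => //; apply: (subsetP FG).
Qed.

Lemma dim_cover n x y : is_complex n -> x < y ->
  (forall z, ~~ (x < z < y)) -> dim y = (dim x).+1.
Proof.
move=> [_ hn] xy hcov; apply/eqP; rewrite eqn_leq dim_lt // andbT.
have [A [hA Ax cA]] := dim_witness x; have [B [hB By cB]] := dim_witness y.
have hup : flag set0 && [forall z in set0, y < z].
  by rewrite flag0; apply/forall_inP => z; rewrite inE.
have [C /maxsetP[/andP[hC /forall_inP yC] Cmax] _] := @maxset_exists _
  (fun F : {set K} => flag F && [forall z in F, y < z]) _ hup.
have yNC : y \notin C by apply/negP => /yC; rewrite ltxx.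
have xNC : x \notin C by apply/negP => /yC /(lt_trans xy); rewrite ltxx.
have hyC : flag (y |: C).
  by apply: flagU1 => // z /yC yz; apply: lt_comparable.
have upC z : y < z -> {in C, forall w, z >=< w} -> z \in C.
  move=> yz hz; rewrite -(Cmax (z |: C)) ?inE ?eqxx ?subsetUr //.
  rewrite flagU1 //=; apply/forall_inP => w; rewrite !inE.
  by move=> /orP[/eqP->|/yC].
have h1 : flag (A :|: (x |: (y |: C))).
  apply: flagU => //.
    apply: flagU1 => // z; rewrite !inE => /orP[/eqP->|/yC yz].
      exact: lt_comparable.
    by apply: lt_comparable; apply: lt_trans yz.
  move=> a z /Ax ax; rewrite !inE => /or3P[/eqP->|/eqP->|/yC yz].
  - exact: lt_comparable.
  - by apply: lt_comparable; apply: lt_trans xy.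
  - by apply: lt_comparable; apply: lt_trans yz; apply: lt_trans xy.
have m1 : maxset flag (A :|: (x |: (y |: C))).
  apply: maxset_flag => // z hz.
  have /hz zx : x \in A :|: (x |: (y |: C)) by rewrite !inE eqxx orbT.
  have /hz zy : y \in A :|: (x |: (y |: C)) by rewrite !inE eqxx !orbT.
  rewrite !inE; case: comparableP zx => // [zx|xz|->] _; last by rewrite orbT.
    suff -> : z \in A by [].
    apply/negPn/negP => zA; have : (#|z |: A| <= dim x)%N.
      apply: dim_ge; first by apply: flagU1 => // w wA; apply: hz; rewrite !inE wA.
      by move=> w; rewrite !inE => /orP[/eqP->|/Ax].
    by rewrite cardsU1 zA cA ltnn.
  case: comparableP zy => // [zy|yz|->] _; last by rewrite !orbT.
    by have := hcov z; rewrite xz zy.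
  by rewrite upC ?orbT // => w wC; apply: hz; rewrite !inE wC !orbT.
have h2 : flag (B :|: (y |: C)).
  apply: flagU => // a z /By ay; rewrite !inE => /orP[/eqP->|/yC yz].
    exact: lt_comparable.
  by apply: lt_comparable; apply: lt_trans yz.
have [G mG sG] := maxset_exists h2.
have := subset_leq_card sG; rewrite (hn _ mG) -(hn _ m1) !cardsU.
have -> : B :&: (y |: C) = set0.
  apply/setP => z; rewrite !inE; apply/negP => /andP[/By zy].
  by move=> /orP[/eqP zE|/yC yz]; [rewrite zE ltxx in zy|have := lt_trans zy yz; rewrite ltxx].
have -> : A :&: (x |: (y |: C)) = set0.
  apply/setP => z; rewrite !inE; apply/negP => /andP[/Ax zx].
  move=> /or3P[/eqP zE|/eqP zE|/yC yz].
  - by rewrite zE ltxx in zx.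
  - by rewrite zE in zx; have := lt_trans xy zx; rewrite ltxx.
  - by have := lt_trans (lt_trans zx xy) yz; rewrite ltxx.
have xNyC : x \notin y |: C by rewrite !inE negb_or (lt_eqF xy).
have -> : [set x] :&: (y |: C) = set0.
  apply/setP => z; rewrite [RHS]inE in_setI in_set1.
  by apply/negP => /andP[/eqP->]; apply/negP.
have -> : [set y] :&: C = set0.
  apply/setP => z; rewrite [RHS]inE in_setI in_set1.
  by apply/negP => /andP[/eqP->]; apply/negP.
rewrite !cards1 !cards0 cA cB; move: (dim x) (dim y) #|C| => a b c.
by clear; lia.
Qed.

End Complex.

(** * The Wythoff construction *)

Section TypeOrder.
Variables (n : nat) (V : {set 'I_n.+1}).
Implicit Types U W : {set 'I_n.+1}.

Definition between (a b c : nat) := (a <= b <= c)%N || (c <= b <= a)%N.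

Definition type_le W U :=
  [forall u in U, forall v in V, exists w in W, between u w v].

Definition type_lt W U := type_le W U && ~~ type_le U W.

Definition type_equiv U W := type_le U W && type_le W U.

(** [U] is the smallest member, with respect to inclusion, of its class. *)
Definition essential U :=
  (U != set0) &&
  [forall W : {set 'I_n.+1}, (W != set0) && type_equiv U W ==> (U \subset W)].

Lemma type_leP W U :
  reflect {in U & V, forall u v : 'I_n.+1, exists2 w, w \in W & between u w v}
          (type_le W U).
Proof.
apply: (iffP forall_inP) => [h u v uU vV|h u uU].
  by have /forall_inP/(_ v vV)/exists_inP := h u uU.
by apply/forall_inP => v vV; apply/exists_inP; apply: h.
Qed.

Lemma type_le_trans : transitive type_le.
Proof.
move=> U W X /type_leP WU /type_leP UX; apply/type_leP => x v xX vV.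
have [u uU hu] := UX x v xX vV; have [w wW hw] := WU u v uU vV.
by exists w => //; move: hu hw; rewrite /between; lia.
Qed.

Lemma type_lt_irr : irreflexive type_lt.
Proof. by move=> U; rewrite /type_lt andbN. Qed.

Lemma type_lt_trans : transitive type_lt.
Proof.
move=> U W X /andP[WU UW] /andP[UX XU]; apply/andP; split.
  exact: type_le_trans UX.
by apply: contra UW => XW; apply: type_le_trans UX XW.
Qed.

Lemma essential_witness U (u : 'I_n.+1) : essential U -> V != set0 -> u \in U ->
  exists2 v : 'I_n.+1, v \in V & {in U, forall w : 'I_n.+1, between u w v -> w = u}.
Proof.
move=> /andP[_ /forallP hU] /set0Pn[v0 v0V] uU.
have [W0|W0] := eqVneq (U :\ u) set0.
  exists v0 => // w wU _; apply/eqP/negPn/negP => wu.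
  by have : w \in U :\ u; [rewrite !inE wu|rewrite W0 inE].
have UW : type_le U (U :\ u).
  apply/type_leP => w v; rewrite !inE => /andP[_ wU] _.
  by exists w => //; rewrite /between; lia.
have : ~~ type_le (U :\ u) U.
  apply/negP => WU; have := hU (U :\ u); rewrite W0 /type_equiv UW WU /=.
  by move=> /subsetP/(_ u uU); rewrite !inE eqxx.
rewrite negb_forall_in => /exists_inP[a aU]; rewrite negb_forall_in.
move=> /exists_inP[v vV]; rewrite negb_exists_in => /forall_inP hv.
have au : a = u.
  apply/eqP/negPn/negP => au.
  by have := hv a; rewrite !inE au aU /between => /(_ isT); lia.
exists v => // w wU hw; apply/eqP/negPn/negP => wu.
by have := hv w; rewrite !inE wu wU au hw => /(_ isT).
Qed.

Lemma type_lt_between W U X (w x : 'I_n.+1) : type_lt W U -> type_lt U X -> essential W ->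
  w \in W -> x \in X -> exists2 u : 'I_n.+1, u \in U & between w u x.
Proof.
move=> /andP[/type_leP WU NUW] /andP[/type_leP UX _] eW wW xX.
have V0 : V != set0.
  apply: contraNneq NUW => V0; apply/type_leP => a b.
  by rewrite V0 inE.
have [v vV hv] := essential_witness eW V0 wW.
have [u uU hu] := UX x v xX vV; have [w' w'W hw'] := WU u v uU vV.
exists u => //; have := hv w' w'W; move: hu hw'; rewrite /between => hu hw' h.
have {}h : between w w' v -> w' = w :> nat by move=> /h ->.
by move: h; rewrite /between; lia.
Qed.

End TypeOrder.

Section Wythoff.
Context {disp : Order.disp_t} {K : finPOrderType disp} {n : nat}.

(** The faces of the Wythoffian; the proof [hK] is recorded in the type because
    the order on these faces is only transitive thanks to it. *)
Record wythoffian (hK : is_complex K n) (V : {set 'I_n.+1}) : Type := Wythoffian {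
  wflag :> {set K};
  wflagP : flag wflag && essential V (flag_type n wflag) }.

Variables (hK : is_complex K n) (V : {set 'I_n.+1}).

HB.instance Definition _ := [isSub for @wflag hK V].
HB.instance Definition _ := [Finite of wythoffian hK V by <:].

Definition wythoff_lt (F' F : wythoffian hK V) :=
  type_lt V (flag_type n F') (flag_type n F) && flag (F :|: F').

Lemma wythoff_lt_irr : irreflexive wythoff_lt.
Proof. by move=> F; rewrite /wythoff_lt type_lt_irr. Qed.

Lemma wythoff_lt_trans : transitive wythoff_lt.
Proof.
move=> G F H /andP[tFG fFG] /andP[tGH fGH].
rewrite /wythoff_lt (type_lt_trans tFG tGH) /=.
have [/andP[hF eF] /andP[hH _]] := (wflagP F, wflagP H).
apply: flagU => // z x zH xF.
have hz : (dim z < n.+1)%N by rewrite ltnS dim_le.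
have hx : (dim x < n.+1)%N by rewrite ltnS dim_le.
have tz : Ordinal hz \in flag_type n H.
  by rewrite inE; apply/exists_inP; exists z.
have tx : Ordinal hx \in flag_type n F.
  by rewrite inE; apply/exists_inP; exists x.
have [u] := type_lt_between tFG tGH eF tx tz.
rewrite inE => /exists_inP[y yG /eqP dy] /=; rewrite -dy => hb.
have cyx : y >=< x by apply: (flagP _ fFG); rewrite !inE ?yG ?xF ?orbT.
have czy : z >=< y by apply: (flagP _ fGH); rewrite !inE ?yG ?zH ?orbT.
case/orP: hb => /andP[h1 h2].
  rewrite comparable_sym; apply: le_comparable; apply: (@le_trans _ _ y).
    by apply: dim_comparable; rewrite // comparable_sym.
  by apply: dim_comparable; rewrite // comparable_sym.
by apply: le_comparable; apply: (@le_trans _ _ y); apply: dim_comparable.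
Qed.

Fact wythoff_display : Order.disp_t. Proof. exact: Order.Disp tt tt. Qed.

HB.instance Definition _ := Order.Lt_isPOrder.Build wythoff_display
  (wythoffian hK V) wythoff_lt_irr wythoff_lt_trans.

End Wythoff.

(** * The simplex *)

Record alpha (d : nat) : Type := Alpha {
  aset :> {set 'I_d.+1};
  asetP : (aset != set0) && (aset != setT) }.

HB.instance Definition _ d := [isSub for @aset d].
HB.instance Definition _ d := [Finite of alpha d by <:].

Definition alpha_le d (X Y : alpha d) := aset X \subset aset Y.

Lemma alpha_le_refl d : reflexive (@alpha_le d).
Proof. by move=> X; apply: subxx. Qed.

Lemma alpha_le_anti d : antisymmetric (@alpha_le d).
Proof. by move=> X Y XY; apply/val_inj/eqP; rewrite eqEsubset. Qed.

Lemma alpha_le_trans d : transitive (@alpha_le d).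
Proof. by move=> Y X Z; apply: subset_trans. Qed.

Fact alpha_display : Order.disp_t. Proof. exact: Order.Disp tt tt. Qed.

HB.instance Definition _ d := Order.Le_isPOrder.Build alpha_display (alpha d)
  (@alpha_le_refl d) (@alpha_le_anti d) (@alpha_le_trans d).

Lemma alpha_leE d (X Y : alpha d) : (X <= Y) = (aset X \subset aset Y).
Proof. by []. Qed.

Lemma alpha_ltE d (X Y : alpha d) : (X < Y) = (aset X \proper aset Y).
Proof. by rewrite lt_leAnge !alpha_leE properE. Qed.

Lemma alpha_card_gt0 d (X : alpha d) : (0 < #|X|)%N.
Proof. by rewrite card_gt0; case/andP: (asetP X). Qed.

Lemma alpha_card_le d (X : alpha d) : (#|X| <= d)%N.
Proof.
case/andP: (asetP X) => _ XT; rewrite -ltnS -[in X in (_ < X)%N](card_ord d.+1).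
by rewrite -cardsT; apply: proper_card; rewrite properT.
Qed.

Lemma subset_between (T : finType) (A B : {set T}) k :
  A \subset B -> (#|A| <= k <= #|B|)%N ->
  exists C : {set T}, [/\ A \subset C, C \subset B & #|C| = k].
Proof.
move=> AB; elim: k => [|k IH] /andP[Ak kB].
  by exists A; split=> //; apply/eqP; rewrite -leqn0.
have [Ak'|kA] := leqP #|A| k; last first.
  by exists A; split=> //; apply/eqP; rewrite eqn_leq Ak kA.
have [|C [AC CB cC]] := IH; first by rewrite Ak' ltnW.
have /set0Pn[x] : B :\: C != set0.
  rewrite -card_gt0 cardsD; have := subset_leq_card (subsetIr B C); lia.
rewrite inE => /andP[xC xB]; exists (x |: C); split.
- exact: subset_trans (subsetUr _ _).
- by rewrite subUset sub1set xB.
- by rewrite cardsU1 xC cC.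
Qed.

Lemma alpha_complex d : (2 <= d)%N -> is_complex (alpha d) d.-1.
Proof.
move=> hd; split.
  have p1 (a : 'I_d.+1) : ([set a] != set0) && ([set a] != setT).
    rewrite -card_gt0 cards1 /=; apply/eqP => /(congr1 (fun A : {set _} => #|A|)).
    by rewrite cards1 cardsT card_ord; lia.
  have p2 (a b : 'I_d.+1) : ([set a; b] != set0) && ([set a; b] != setT).
    rewrite -card_gt0 cards2 /=; apply/eqP => /(congr1 (fun A : {set _} => #|A|)).
    by rewrite cards2 cardsT card_ord; case: (a != b); lia.
  move=> X Y; have [/andP[/set0Pn[a aX] _] /andP[/set0Pn[b bY] _]] := (asetP X, asetP Y).
  apply: (@connect_trans _ _ (Alpha (p1 a))).
    by apply: connect1; rewrite comparable_sym le_comparable // alpha_leE sub1set.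
  apply: (@connect_trans _ _ (Alpha (p2 a b))).
    by apply: connect1; rewrite le_comparable // alpha_leE sub1set !inE eqxx.
  apply: (@connect_trans _ _ (Alpha (p1 b))).
    apply: connect1; rewrite comparable_sym le_comparable // alpha_leE sub1set.
    by rewrite !inE eqxx orbT.
  by apply: connect1; rewrite le_comparable // alpha_leE sub1set.
move=> F /maxsetP[hF Fmax]; have /flagP cF := hF.
pose f (X : alpha d) : 'I_d.-1.+1 := inord #|X|.-1.
have fE X : f X = #|X|.-1 :> nat.
  by rewrite inordK //; have := alpha_card_gt0 X; have := alpha_card_le X; lia.
have finj : {in F &, injective f}.
  move=> X Y XF YF /(congr1 val) /=; rewrite !fE => cXY.
  have {}cXY : #|X| = #|Y| by have := alpha_card_gt0 X; have := alpha_card_gt0 Y; lia.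
  apply/val_inj/eqP; case/orP: (cF X Y XF YF); rewrite alpha_leE => XY.
    by rewrite eqEcard XY cXY /=.
  by rewrite eq_sym eqEcard XY cXY /=.
rewrite -(card_in_imset finj) (_ : f @: F = setT) ?cardsT ?card_ord //.
apply/setP => i; rewrite inE; apply/negPn/negP => iF.
pose A : {set 'I_d.+1} := \bigcup_(X in F | (#|X| <= i.+1)%N) aset X.
pose B : {set 'I_d.+1} := \bigcap_(X in F | (i < #|X|)%N) aset X.
have NF X : X \in F -> #|X| != i.+1.
  move=> XF; apply: contra iF => /eqP cX; apply/imsetP; exists X => //.
  by apply: val_inj; rewrite /= fE cX.
have cardF X Y : X \in F -> Y \in F -> (#|X| <= i.+1)%N -> (i < #|Y|)%N ->
    aset X \subset aset Y.
  move=> XF YF Xi iY; case/orP: (cF X Y XF YF); rewrite alpha_leE //.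
  by move=> /subset_leq_card; have := NF X XF; have := NF Y YF; lia.
have AB : A \subset B.
  apply/bigcupsP => X /andP[XF Xi]; apply/bigcapsP => Y /andP[YF iY].
  exact: cardF.
have cA : (#|A| <= i.+1)%N.
  have [/existsP[X0 hX0]|/existsPn h0] :=
    boolP [exists X, (X \in F) && (#|aset X| <= i.+1)%N]; last first.
    rewrite /A big_pred0 ?cards0 // => X; exact: negbTE (h0 X).
  case: (@arg_maxnP _ X0 (fun X : alpha d => (X \in F) && (#|X| <= i.+1)%N)
    (fun X : alpha d => #|X|) hX0) => X /andP[XF Xi] Xmax.
  apply: leq_trans Xi; apply: subset_leq_card; apply/bigcupsP => Y /andP[YF Yi].
  have := Xmax Y; rewrite YF Yi => /(_ isT) cYX.
  case/orP: (cF Y X YF XF); rewrite alpha_leE // => XY.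
  by have/eqP -> : aset X == aset Y by rewrite eqEcard XY.
have cB : (i.+1 <= #|B|)%N.
  have [/existsP[X0 hX0]|/existsPn h0] :=
    boolP [exists X, (X \in F) && (i < #|aset X|)%N]; last first.
    rewrite /B big_pred0 ?cardsT ?card_ord; last by move=> X; exact: negbTE (h0 X).
    by have := ltn_ord i; lia.
  case: (@arg_minnP _ X0 (fun X : alpha d => (X \in F) && (i < #|X|)%N)
    (fun X : alpha d => #|X|) hX0) => X /andP[XF Xi] Xmin.
  apply: leq_trans Xi _; apply: subset_leq_card; apply/bigcapsP => Y /andP[YF Yi].
  have := Xmin Y; rewrite YF Yi => /(_ isT) cXY.
  case/orP: (cF X Y XF YF); rewrite alpha_leE // => YX.
  by have/eqP -> : aset Y == aset X by rewrite eqEcard YX.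
have [|C [AC CB cC]] := subset_between AB (_ : (#|A| <= i.+1 <= #|B|)%N).
  by rewrite cA cB.
have pC : (C != set0) && (C != setT).
  rewrite -card_gt0 cC /=; apply/eqP => /(congr1 (fun A : {set _} => #|A|)).
  by rewrite cC cardsT card_ord; have := ltn_ord i; lia.
have : Alpha pC \in F.
  rewrite -(Fmax (Alpha pC |: F)) ?inE ?eqxx ?subsetUr // flagU1 // => X XF.
  have [Xi|iX] := leqP #|aset X| i.+1.
    rewrite comparable_sym le_comparable // alpha_leE; apply: subset_trans AC.
    by apply: (bigcup_max X); rewrite ?XF.
  rewrite le_comparable // alpha_leE; apply: subset_trans CB _.
  by apply: (bigcap_min X); rewrite ?XF //= ltnW.
by move=> /NF; rewrite cC eqxx.
Qed.

Lemma dim_alpha d (X : alpha d) : (2 <= d)%N -> dim X = #|X|.-1.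
Proof.
move=> /alpha_complex hK; move: {2}#|X| (erefl #|X|) => k.
elim: k X => [|k IH] X cX; first by have := alpha_card_gt0 X; rewrite cX.
have [k0|k0] := posnP k.
  rewrite cX k0; apply: dim_minimal => Y; apply/negP; rewrite alpha_ltE.
  by move=> /proper_card; have := alpha_card_gt0 Y; lia.
have [|Y [_ YX cY]] := @subset_between _ set0 (aset X) k (sub0set _).
  by rewrite cards0 cX leqnSn.
have pY : (Y != set0) && (Y != setT).
  rewrite -card_gt0 cY k0; apply/eqP => /(congr1 (fun A : {set _} => #|A|)).
  by rewrite cY cardsT card_ord => kd; have := alpha_card_le X; rewrite cX kd; lia.
rewrite (@dim_cover _ _ _ (Alpha pY) X hK) ?(IH (Alpha pY)) //= ?cX ?cY.
- by rewrite prednK.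
- by rewrite alpha_ltE /= properEcard YX cX cY /=.
move=> Z; rewrite !alpha_ltE /=; apply/negP => /andP[].
move=> /proper_card h1 /proper_card h2; move: (leq_ltn_trans h1 h2).
by rewrite cX cY ltnn.
Qed.

(** * Graphs *)

Record sgraph : Type := SGraph {
  vertex :> finType;
  adj : rel vertex;
  adj_sym : symmetric adj;
  adj_irrefl : irreflexive adj }.

Definition isomorphic (G H : sgraph) : Prop :=
  exists f : G -> H, bijective f /\ forall x y, adj (f x) (f y) = adj x y.

Definition walk (G : sgraph) (k : nat) (x y : G) : Prop :=
  exists p : seq G, [/\ path (@adj G) x p, last x p = y & size p = k].

(** No [k] satisfies [is_dist k x y] when [x] and [y] are not connected. *)
Definition is_dist (G : sgraph) (k : nat) (x y : G) : Prop :=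
  walk k x y /\ forall j, walk j x y -> (k <= j)%N.

Section Induced.
Variables (G : sgraph) (S : {set G}).

Definition induced_adj (x y : {x : G | x \in S}) := adj (val x) (val y).

Lemma induced_adj_sym : symmetric induced_adj.
Proof. by move=> x y; apply: adj_sym. Qed.

Lemma induced_adj_irrefl : irreflexive induced_adj.
Proof. by move=> x; apply: adj_irrefl. Qed.

Definition induced : sgraph :=
  @SGraph {x : G | x \in S} induced_adj induced_adj_sym induced_adj_irrefl.

Definition isometric : Prop := forall (x y : induced) (k : nat),
  is_dist k x y <-> is_dist k (val x) (val y).

End Induced.

Section Hypercube.
Variable m : nat.
Implicit Types x y : {ffun 'I_m -> bool}.

Definition hypercube_adj x y := #|[set i | x i != y i]| == 1%N.

Lemma hypercube_adj_sym : symmetric hypercube_adj.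
Proof.
move=> x y; congr (_ == _); apply: eq_card => i.
by rewrite !inE eq_sym.
Qed.

Lemma hypercube_adj_irrefl : irreflexive hypercube_adj.
Proof.
move=> x; rewrite /hypercube_adj (_ : [set i | _] = set0) ?cards0 //.
by apply/setP => i; rewrite !inE eqxx.
Qed.

Definition hypercube : sgraph :=
  @SGraph {ffun 'I_m -> bool} hypercube_adj hypercube_adj_sym hypercube_adj_irrefl.

Definition antipodal (x y : hypercube) : Prop := forall i : 'I_m, x i != y i.

End Hypercube.

Section Skeleton.
Context {disp : Order.disp_t} (K : finPOrderType disp).

(** The vertices are the faces of dimension 0; two distinct ones are adjacent
    when they are the vertices of an edge, i.e. of a face of dimension 1. *)
Definition skeleton_adj (x y : {x : K | dim x == 0%N}) :=
  (x != y) && [exists e : K, [&& dim e == 1%N, val x < e & val y < e]].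

Lemma skeleton_adj_sym : symmetric skeleton_adj.
Proof.
move=> x y; rewrite /skeleton_adj eq_sym; congr (_ && _).
by apply: eq_existsb => e; rewrite [(val x < e) && _]andbC.
Qed.

Lemma skeleton_adj_irrefl : irreflexive skeleton_adj.
Proof. by move=> x; rewrite /skeleton_adj eqxx. Qed.

Definition skeleton : sgraph :=
  @SGraph {x : K | dim x == 0%N} skeleton_adj skeleton_adj_sym skeleton_adj_irrefl.

End Skeleton.

(* Main.v *)
Require Import Defs.
From mathcomp Require Import all_boot all_order.
From mathcomp Require Import zify.

Set Implicit Arguments.
Unset Strict Implicit.
Unset Printing Implicit Defensive.

Import Order.TTheory.
Local Open Scope order_scope.

(** Both extreme dimensions bound an interval: for [V = {0, n}] the relation
    [type_le V W U] says that the range [[min W, max W]] contains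
    [[min U, max U]].  Hence the essential types are the pairs [{a, b}] with
    [a <= b], possibly equal, and a face of the Wythoffian of a complex [K] is a
    pair [{X, Y}] with [X <= Y] in [K], that is, an interval of [K]
    ([face_is_interval]).  Smaller faces correspond to larger intervals
    ([interval_face_lt]), so the dual Wythoffian is the poset of the intervals
    of [K] ordered by inclusion.

    For the simplex, the intervals [[X, Y]] are those of the proper nonempty
    subsets, and the dimension of [[X, Y]] in the dual is the number of elements
    of [Y] outside [X] ([dim_dual_face]).  The vertices are therefore the proper
    nonempty subsets, and an edge joins [X] to [Y] when they differ by one
    element ([skeleton_adjE]).  Identifying a subset [A] with the hypercube
    vertex that differs from [u] exactly on [A] turns this into the hypercube
    adjacency, and the two missing subsets, the empty and the full one, become
    [u] and its antipode [v] ([skeleton_isomorphic]).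

    For the isometry, it suffices to join any two remaining vertices [x] and [y]
    by a walk that avoids [u] and [v] and has the Hamming distance as its length.
    Such a walk is built by stepping towards [y]: if the distance is 1, the step
    reaches [y]; if it is at least 2, two different neighbours of [x] are closer
    to [y], and both cannot be removed, since two neighbours of [x] differ in two
    coordinates only whereas [u] and [v] differ in all [d + 1 >= 3] of them
    ([exists_closer_neighbour]). *)

(** * Dimension as a rank function *)

(** A flag strictly below [x] is a chain, on which [r] is injective with values
    below [r x]. *)
Lemma dim_le_rank (disp : Order.disp_t) (K : finPOrderType disp) (r : K -> nat) (x : K) :
  {homo r : y z / y < z >-> (y < z)%N} -> (dim x <= r x)%N.
Proof.
move=> rlt; have [F [/flagP hF Fx <-]] := dim_witness x.
have rF y : y \in F -> (r y < r x)%N by move=> /Fx; apply: rlt.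
pose f (y : K) : 'I_(r x).+1 := inord (r y).
have finj : {in F &, injective f}.
  move=> y z yF zF /(congr1 val) /=; rewrite !inordK ?ltnS 1?ltnW ?rF // => ryz.
  case: (comparableP y z) (hF y z yF zF) => // /rlt; by rewrite ryz ltnn.
(* [f] takes values in an ordinal type with one element too many, so that it is
   never empty; the bound is recovered because the top value is not reached. *)
rewrite -(card_in_imset finj) -ltnS -[X in (_ < X)%N]card_ord -cardsT.
apply: proper_card; rewrite properT; apply/eqP => fT.
have /imsetP[y yF /(congr1 val)] : ord_max \in f @: F by rewrite fT inE.
have ry := rF y yF.
rewrite /= inordK; last by rewrite ltnS ltnW.
by move=> e; move: ry; rewrite -e ltnn.
Qed.

Lemma dim_eq_rank (disp : Order.disp_t) (K : finPOrderType disp) (r : K -> nat) (x : K) :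
  {homo r : y z / y < z >-> (y < z)%N} ->
  (forall y, (0 < r y)%N -> exists2 z, z < y & r y = (r z).+1) ->
  dim x = r x.
Proof.
move=> rlt rpred; apply/eqP; rewrite eqn_leq dim_le_rank //=.
move: {2}(r x) (erefl (r x)) => k; elim: k x => [|k IH] x rx; first by rewrite rx.
have [|z zx rz] := rpred x; first by rewrite rx.
rewrite rz; apply: leq_ltn_trans (dim_lt zx); apply: IH.
by move: rz; rewrite rx => -[].
Qed.

(** * Types for the two extreme dimensions *)

Section EndTypes.
Variable n : nat.
Implicit Types a b : 'I_n.+1.

Let V : {set 'I_n.+1} := [set ord0; ord_max].

(** A number lies between [u] and [ord0] when it is at most [u], and between [u]
    and [ord_max] when it is at least [u]. *)
Lemma type_le_ends (W U : {set 'I_n.+1}) :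
  reflect {in U, forall u : 'I_n.+1, (exists2 w : 'I_n.+1, w \in W & w <= u)%N /\
                           (exists2 w : 'I_n.+1, w \in W & u <= w)%N}
    (type_le V W U).
Proof.
apply: (iffP (type_leP _ _ _)) => [h u uU|h u v uU].
  split.
    have [|w wW hw] := h u ord0 uU; first by rewrite !inE eqxx.
    by exists w => //; move: hw; rewrite /between /=; lia.
  have [|w wW hw] := h u ord_max uU; first by rewrite !inE eqxx orbT.
  by exists w => //; move: hw (ltn_ord u); rewrite /between /=; lia.
have [[w wW wu] [w' w'W uw']] := h u uU.
rewrite !inE => /orP[]/eqP->; [exists w|exists w'] => //; rewrite /between /=.
  lia.
by have := ltn_ord w'; lia.
Qed.

Lemma type_le_pair a b a' b' : (a <= b)%N -> (a' <= b')%N ->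
  type_le V [set a'; b'] [set a; b] = (a' <= a)%N && (b <= b')%N.
Proof.
move=> ab ab'; apply/type_le_ends/andP => [h|[aa bb] u].
  split.
    have [|[w]] := h a; first by rewrite !inE eqxx.
    by rewrite !inE => /orP[]/eqP->; lia.
  have [|_ [w]] := h b; first by rewrite !inE eqxx orbT.
  by rewrite !inE => /orP[]/eqP->; lia.
rewrite !inE => hu; split; [exists a'|exists b']; rewrite ?inE ?eqxx ?orbT //.
  by case/orP: hu => /eqP->; lia.
by case/orP: hu => /eqP->; lia.
Qed.

(** A type equivalent to [{a, b}] has the same minimum and the same maximum, so
    it contains both. *)
Lemma essential_pair a b : (a <= b)%N -> essential V [set a; b].
Proof.
move=> ab; apply/andP; split.
  by apply/set0Pn; exists a; rewrite !inE eqxx.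
apply/forallP => W; apply/implyP => /andP[_ /andP[/type_le_ends UW /type_le_ends WU]].
have aU : a \in [set a; b] by rewrite !inE eqxx.
have bU : b \in [set a; b] by rewrite !inE eqxx orbT.
apply/subsetP => x; rewrite !inE => /orP[]/eqP->.
  have [[w wW wa] _] := WU a aU; have [[y yU yw] _] := UW w wW.
  suff -> : a = w by [].
  by apply: ord_inj; move: yU; rewrite !inE => /orP[]/eqP yE; subst y; lia.
have [_ [w wW bw]] := WU b bU; have [_ [y yU wy]] := UW w wW.
suff -> : b = w by [].
by apply: ord_inj; move: yU; rewrite !inE => /orP[]/eqP yE; subst y; lia.
Qed.

(** Keeping only the minimum and the maximum of a type does not change its
    class. *)
Lemma essential_is_pair (U : {set 'I_n.+1}) : essential V U ->
  exists a b, (a <= b)%N /\ U = [set a; b].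
Proof.
move=> /andP[/set0Pn[c cU] /forallP hU].
have [a aU amin] := @arg_minnP _ c (mem U) (fun i : 'I_n.+1 => i : nat) cU.
have [b bU bmax] := @arg_maxnP _ c (mem U) (fun i : 'I_n.+1 => i : nat) cU.
rewrite /= in aU bU.
exists a, b; split; first exact: amin.
apply/eqP; rewrite eqEsubset subUset !sub1set aU bU !andbT.
have := hU [set a; b]; move/implyP; apply; apply/andP; split.
  by apply/set0Pn; exists a; rewrite !inE eqxx.
apply/andP; split; apply/type_le_ends => x.
  by rewrite !inE => /orP[]/eqP->; split; [exists a|exists a|exists b|exists b].
move=> xU; split; [exists a|exists b]; rewrite ?inE ?eqxx ?orbT //.
  exact: amin.
exact: bmax.
Qed.

End EndTypes.

(** * Faces of the Wythoffian as intervals *)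

Section IntervalFaces.
Context {disp : Order.disp_t} {K : finPOrderType disp} {n : nat}.
Variable hK : is_complex K n.
Implicit Types (X Y : K) (F : {set K}).

Let V : {set 'I_n.+1} := [set ord0; ord_max].
Notation face := (wythoffian hK V).

Definition dim_ord X : 'I_n.+1 := inord (dim X).

Lemma val_dim_ord X : dim_ord X = dim X :> nat.
Proof. by rewrite inordK // ltnS dim_le. Qed.

Lemma flag_type_imset F : flag_type n F = dim_ord @: F.
Proof.
apply/setP => i; rewrite inE; apply/exists_inP/imsetP => -[X XF].
  by move=> /eqP hX; exists X => //; apply: ord_inj; rewrite val_dim_ord.
by move=> ->; exists X; rewrite // val_dim_ord.
Qed.

Lemma flag_type_pair X Y : flag_type n [set X; Y] = [set dim_ord X; dim_ord Y].
Proof. by rewrite flag_type_imset imsetU1 imset_set1. Qed.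

Lemma dim_mono X Y : X <= Y -> (dim X <= dim Y)%N.
Proof. by rewrite le_eqVlt => /orP[/eqP->//|/dim_lt/ltnW]. Qed.

Lemma interval_faceP X Y : X <= Y ->
  flag [set X; Y] && essential V (flag_type n [set X; Y]).
Proof.
move=> XY; rewrite flag_type_pair essential_pair ?val_dim_ord ?dim_mono // andbT.
apply: flagU1; first by apply/flagP => x y; rewrite !inE => /eqP-> /eqP->; exact: comparablexx.
by move=> y; rewrite inE => /eqP->; apply: le_comparable.
Qed.

Definition interval_face X Y (XY : X <= Y) : face := Wythoffian hK (interval_faceP XY).

(** The dimension is injective on a flag, so a flag of type [{a, b}] consists of
    its elements of dimensions [a] and [b]. *)
Lemma face_is_interval (F : face) : exists X Y, X <= Y /\ wflag F = [set X; Y].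
Proof.
have /andP[hF /essential_is_pair[a [b [ab tF]]]] := wflagP F.
have dimF X Y : X \in wflag F -> Y \in wflag F -> (dim X <= dim Y)%N -> X <= Y.
  by move=> XF YF; apply: dim_comparable; apply: (flagP _ hF).
have : a \in flag_type n F by rewrite tF !inE eqxx.
rewrite flag_type_imset => /imsetP[X XF aX].
have : b \in flag_type n F by rewrite tF !inE eqxx orbT.
rewrite flag_type_imset => /imsetP[Y YF bY].
have XY : X <= Y by apply: dimF => //; rewrite -!val_dim_ord -aX -bY.
exists X, Y; split=> //; apply/eqP; rewrite eqEsubset subUset !sub1set XF YF !andbT.
apply/subsetP => Z ZF.
have : dim_ord Z \in flag_type n F by rewrite flag_type_imset imset_f.
rewrite tF aX bY !inE => /orP[]/eqP/(congr1 val); rewrite /= !val_dim_ord => dZ;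
  apply/orP; [left|right]; apply/eqP/le_anti; by rewrite !dimF ?dZ.
Qed.

(** Inside a flag the order of the faces is the order of their dimensions, so the
    inclusion of the ranges of dimensions becomes the inclusion of the intervals
    as soon as the union is a flag. *)
Lemma interval_face_lt (F F' : face) X Y X' Y' : X <= Y -> X' <= Y' ->
  wflag F = [set X; Y] -> wflag F' = [set X'; Y'] ->
  (F' < F) = [&& X' <= X, Y <= Y' & (X' < X) || (Y < Y')].
Proof.
move=> XY XY' EF EF'; rewrite -[F' < F]/(wythoff_lt F' F) /wythoff_lt /type_lt EF EF'.
rewrite !flag_type_pair !type_le_pair ?val_dim_ord; try exact: dim_mono.
rewrite negb_and -!ltnNge.
apply/andP/and3P => [[/andP[/andP[dX dY] dlt] hU]|[XX YY lt]].
  have {}hU x y : x \in [set X; Y] -> y \in [set X'; Y'] -> x >=< y.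
    by move=> xF yF; apply: (flagP _ hU); rewrite inE ?xF ?yF ?orbT.
  have hX : X' <= X.
    by apply: dim_comparable; rewrite // comparable_sym hU // !inE eqxx.
  have hY : Y <= Y' by apply: dim_comparable; rewrite // hU // !inE eqxx orbT.
  split=> //; move: hX hY dlt; rewrite !le_eqVlt => /orP[/eqP->|->//] /orP[/eqP->|->].
    by rewrite !ltnn.
  by rewrite orbT.
split.
  rewrite !dim_mono //=; case/orP: lt => /dim_lt->; by rewrite ?orbT.
have XY'' := le_trans XX (le_trans XY YY).
apply: flagU.
- by case/andP: (interval_faceP XY).
- by case/andP: (interval_faceP XY').
move=> x y; rewrite !inE => /orP[]/eqP-> /orP[]/eqP->.
- by rewrite comparable_sym le_comparable.
- exact/le_comparable/(le_trans XY).
- by rewrite comparable_sym; apply/le_comparable/(le_trans XX).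
- exact: le_comparable.
Qed.

End IntervalFaces.

(** * The dual Wythoffian of the simplex *)

Section SimplexFaces.
Variables (d : nat) (hd : (2 <= d)%N).

Let V : {set 'I_d.-1.+1} := [set ord0; ord_max].
Notation face := (wythoffian (alpha_complex hd) V).
Implicit Types F G : face.

(** By [face_is_interval] a face is a pair of nested subsets; its intersection
    and its union recover the smaller and the larger one without a choice. *)
Definition lower F : {set 'I_d.+1} := \bigcap_(X in wflag F) aset X.
Definition upper F : {set 'I_d.+1} := \bigcup_(X in wflag F) aset X.

Lemma ends_interval F (X Y : alpha d) : X <= Y -> wflag F = [set X; Y] ->
  lower F = X /\ upper F = Y.
Proof.
rewrite alpha_leE => XY EF; rewrite /lower /upper EF; split.
  by rewrite bigcap_setU !big_set1; apply/setIidPl.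
by rewrite bigcup_setU !big_set1; apply/setUidPr.
Qed.

Lemma ends_interval_face (X Y : alpha d) (XY : X <= Y) :
  lower (interval_face (alpha_complex hd) XY) = X /\
  upper (interval_face (alpha_complex hd) XY) = Y.
Proof. exact: ends_interval. Qed.

Lemma lower_upper F : lower F \subset upper F.
Proof.
have [X [Y [XY EF]]] := face_is_interval F.
by have [-> ->] := ends_interval XY EF.
Qed.

Lemma lower_proper F : (lower F != set0) && (lower F != setT).
Proof.
have [X [Y [XY EF]]] := face_is_interval F.
by have [-> _] := ends_interval XY EF; apply: asetP.
Qed.

Lemma face_inj F G : lower F = lower G -> upper F = upper G -> F = G.
Proof.
have [X [Y [XY EF]]] := face_is_interval F.
have [X' [Y' [XY' EG]]] := face_is_interval G.
have [-> ->] := ends_interval XY EF; have [-> ->] := ends_interval XY' EG.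
by move=> /val_inj EX /val_inj EY; apply: val_inj; rewrite /= EF EG EX EY.
Qed.

Definition face_rank F := #|upper F :\: lower F|.

(** Strictness is expressed by the rank, which makes the strict monotonicity of
    [face_rank] immediate. *)
Lemma dual_face_lt (F G : face^d) :
  (F < G) = [&& lower G \subset lower F, upper F \subset upper G
              & (face_rank F < face_rank G)%N].
Proof.
rewrite -[F < G]/((G : face) < (F : face)).
have [X [Y [XY EF]]] := face_is_interval F.
have [X' [Y' [XY' EG]]] := face_is_interval G.
rewrite (interval_face_lt XY XY' EF EG) /face_rank.
have [-> ->] := ends_interval XY EF; have [-> ->] := ends_interval XY' EG.
rewrite !alpha_leE !alpha_ltE.
case XX: (aset X' \subset X) => //=; case YY: (aset Y \subset Y') => //=.
rewrite !properEcard XX YY /= !cardsD.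
move: XY XY'; rewrite !alpha_leE => XY XY'; rewrite (setIidPr XY) (setIidPr XY').
have := subset_leq_card XX; have := subset_leq_card YY.
have := subset_leq_card XY; have := subset_leq_card XY'.
by move: #|aset X| #|aset Y| #|aset X'| #|aset Y'| => x y x' y'; clear; lia.
Qed.

(** A nondegenerate interval [[X, Y]] contains [[X, Y :\ i]] for every [i] in
    [Y :\: X], which has one less in rank; [Y :\ i] is nonempty because it
    contains [X], and proper because it misses [i]. *)
Lemma dim_dual_face (F : face^d) : dim F = face_rank F.
Proof.
apply: dim_eq_rank => [G H|G]; first by rewrite dual_face_lt => /and3P[].
have [X [Y [XY EG]]] := face_is_interval G.
have [lG uG] := ends_interval XY EG.
rewrite /face_rank lG uG => /card_gt0P[i]; rewrite inE => /andP[iX iY].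
move: (XY); rewrite alpha_leE => sXY.
have sXZ : aset X \subset aset Y :\ i.
  by apply/subsetD1P.
have pZ : (aset Y :\ i != set0) && (aset Y :\ i != setT).
  apply/andP; split.
    by apply: contraTneq sXZ => ->; rewrite subset0; case/andP: (asetP X).
  by apply/eqP => /setP/(_ i); rewrite !inE eqxx.
have XZ : X <= Alpha pZ by rewrite alpha_leE.
have [lZ uZ] := ends_interval_face XZ.
exists (interval_face (alpha_complex hd) XZ : face^d).
  rewrite dual_face_lt /face_rank lG uG lZ uZ /= subxx subsetDl /=.
  by rewrite [X in (_ < X)%N](cardsD1 i) !inE iX iY /= setDDl setUC -setDDl.
by rewrite lZ uZ /= (cardsD1 i) !inE iX iY /= setDDl setUC -setDDl.
Qed.

End SimplexFaces.

(** * The skeleton *)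

Section DualSkeleton.
Variables (d : nat) (hd : (2 <= d)%N).

Let V : {set 'I_d.-1.+1} := [set ord0; ord_max].
Notation face := (wythoffian (alpha_complex hd) V).
Notation skel := (skeleton face^d).
Implicit Types x y : skel.

Definition vertex_set x : {set 'I_d.+1} := lower (val x).

Lemma vertex_upper x : upper (val x) = vertex_set x.
Proof.
apply/eqP; rewrite eqEsubset lower_upper andbT -setD_eq0 -cards_eq0.
by have := valP x; rewrite /= dim_dual_face.
Qed.

Lemma vertex_set_inj : injective vertex_set.
Proof.
move=> x y xy; apply: val_inj; apply: face_inj => //.
by rewrite !vertex_upper.
Qed.

Lemma vertex_set_onto (A : {set 'I_d.+1}) : A != set0 -> A != setT ->
  exists x, vertex_set x = A.
Proof.
move=> A0 AT; have pA : (A != set0) && (A != setT) by rewrite A0.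
have [lA uA] := ends_interval_face hd (lexx (Alpha pA)).
have v0 : dim (interval_face (alpha_complex hd) (lexx (Alpha pA)) : face^d) == 0%N.
  by rewrite dim_dual_face /face_rank lA uA setDv cards0.
by exists (exist (fun F : face^d => dim F == 0%N) _ v0).
Qed.

(** If an edge [[X, Y]] contains the vertices [A] and [B], their symmetric
    difference lies in [Y :\: X], which is a singleton.  Conversely, a singleton
    symmetric difference forces [A] and [B] to be nested, and the interval
    between them is an edge. *)
Lemma skeleton_adjE x y :
  adj x y = (#|(vertex_set x :\: vertex_set y) :|: (vertex_set y :\: vertex_set x)| == 1%N).
Proof.
set A := vertex_set x; set B := vertex_set y.
apply/andP/idP => [[xy /existsP[e /and3P[]]]|AB1].
  rewrite dim_dual_face /face_rank => /eqP e1.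
  rewrite !dual_face_lt !vertex_upper => /and3P[lx ux _] /and3P[ly uy _].
  rewrite eqn_leq -{1}e1; apply/andP; split.
    apply: subset_leq_card; rewrite subUset; apply/andP; split.
      exact: setDSS.
    exact: setDSS.
  rewrite card_gt0 setU_eq0 !setD_eq0 -eqEsubset.
  by apply: contra xy => /eqP/vertex_set_inj->.
wlog AB : x y @A @B AB1 / A \subset B => [wl|].
  have [AB|nAB] := boolP (A \subset B); first exact: (wl x y).
  have BA : B \subset A.
    rewrite -setD_eq0 -cards_eq0; move: AB1; rewrite cardsU.
    have -> : (A :\: B) :&: (B :\: A) = set0.
      by apply/setP => i; rewrite !inE; case: (i \in A); case: (i \in B).
    by move: nAB; rewrite -setD_eq0 -cards_eq0 cards0; lia.
  have [|yx /existsP[e /and3P[e1 ey ex]]] := wl y x _ BA; first by rewrite setUC.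
  by split; [rewrite eq_sym|apply/existsP; exists e; rewrite e1 ex ey].
have AB0 : A :\: B = set0 by apply/eqP; rewrite setD_eq0.
rewrite AB0 set0U in AB1.
have pA : (A != set0) && (A != setT) := lower_proper (val x).
have pB : (B != set0) && (B != setT) := lower_proper (val y).
have XY : Alpha pA <= Alpha pB by rewrite alpha_leE.
have [le ue] := ends_interval_face hd XY.
split.
  by apply/eqP => xy; move: AB1; rewrite /A /B xy setDv cards0.
apply/existsP; exists (interval_face (alpha_complex hd) XY : face^d).
rewrite !dual_face_lt !vertex_upper !dim_dual_face /face_rank !vertex_upper !setDv.
by rewrite le ue !cards0 /= (eqP AB1) !subxx AB.
Qed.

End DualSkeleton.

(** * Distances in the hypercube *)

Section HammingDistance.
Variable m : nat.
Implicit Types x y z : hypercube m.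

Definition hamming x y := #|[set i | x i != y i]|.

Lemma hamming_eq0 x y : (hamming x y == 0%N) = (x == y).
Proof.
rewrite cards_eq0; apply/eqP/eqP => [/setP xy|->].
  by apply/ffunP => i; have := xy i; rewrite !inE => /negbFE/eqP.
by apply/setP => i; rewrite !inE eqxx.
Qed.

Lemma hamming_adj x z y : adj x z -> (hamming x y <= (hamming z y).+1)%N.
Proof.
rewrite /= /hypercube_adj => /eqP xz; rewrite -add1n -xz.
apply: leq_trans (leq_card_setU _ _); apply: subset_leq_card.
apply/subsetP => i; rewrite !inE.
by case: (x i); case: (y i); case: (z i).
Qed.

Lemma hamming_walk k x y : walk k x y -> (hamming x y <= k)%N.
Proof.
move=> [p [+ + <-]]; elim: p x => [|z p IH] x /=.
  by move=> _ ->; rewrite leqn0 hamming_eq0.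
by move=> /andP[xz zp] lz; apply: leq_trans (hamming_adj y xz) _; rewrite ltnS IH.
Qed.

Definition flip i x : hypercube m := [ffun j => if j == i then ~~ x j else x j].

Lemma adj_flip i x : adj x (flip i x).
Proof.
rewrite /= /hypercube_adj (_ : [set j | _] = [set i]) ?cards1 //.
by apply/setP => j; rewrite !inE ffunE; case: (j == i); rewrite ?eqxx //; case: (x j).
Qed.

Lemma hamming_flip i x y : x i != y i -> hamming x y = (hamming (flip i x) y).+1.
Proof.
move=> xy; rewrite /hamming (cardsD1 i) !inE xy add1n; congr (_.+1).
apply: eq_card => j; rewrite !inE ffunE; case: eqP => //= ->.
by move: xy; case: (x i); case: (y i).
Qed.

End HammingDistance.

(** * Walks and distances in graphs *)

Lemma is_dist_minimal (G : sgraph) (x y : G) k0 k : walk k0 x y ->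
  (forall j, walk j x y -> (k0 <= j)%N) -> is_dist k x y <-> k = k0.
Proof.
move=> w0 min0; split=> [[wk mink]|->]; last by split.
by apply/eqP; rewrite eqn_leq mink // min0.
Qed.

Lemma walk_val (G : sgraph) (S : {set G}) k (x y : induced S) :
  walk k x y -> walk k (val x) (val y).
Proof.
move=> [p [xp ly pk]]; exists (map val p); split.
- by rewrite path_map.
- by rewrite last_map ly.
- by rewrite size_map.
Qed.

(** * The hypercube without two antipodal vertices *)

Section TwoAntipodesRemoved.
Variables (m : nat) (u v : hypercube m).
Hypotheses (hm : (3 <= m)%N) (huv : antipodal u v).

Let S : {set hypercube m} := ~: [set u; v].

(** If the first coordinate [i] leads to a removed vertex, that vertex is not
    [y], hence there is a second coordinate [j] to flip.  If that led to a
    removed vertex too, the two flips of [x], which differ at [i], would be [u]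
    and [v], but they agree at any third coordinate [l]. *)
Lemma exists_closer_neighbour (x y : hypercube m) : x \in S -> y \in S -> x != y ->
  exists2 i, x i != y i & flip i x \in S.
Proof.
move=> xS yS; rewrite -hamming_eq0 => xy0.
have [i] : exists i, i \in [set i | x i != y i] by apply/card_gt0P; rewrite lt0n.
rewrite inE => xyi.
have [iS|iS] := boolP (flip i x \in S); first by exists i.
have : (0 < hamming (flip i x) y)%N.
  rewrite lt0n hamming_eq0; apply: contraNneq iS => ->; exact: yS.
case/card_gt0P => j; rewrite inE => xyj.
have ji : j != i.
  apply: contraNneq xyj => ->; rewrite ffunE eqxx.
  by move: xyi; case: (x i); case: (y i).
exists j; first by move: xyj; rewrite ffunE (negPf ji).
apply: contraT => jS.
have [l] : exists l, l \in ~: [set i; j].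
  by apply/card_gt0P; rewrite cardsCs setCK card_ord cards2 eq_sym ji; lia.
rewrite !inE negb_or => /andP[/negPf li /negPf lj].
have eqij : flip i x != flip j x.
  apply/eqP => /ffunP/(_ i); rewrite !ffunE eqxx eq_sym (negPf ji).
  by case: (x i).
have eql : flip i x l = flip j x l by rewrite !ffunE li lj.
move: iS jS eqij eql; rewrite !inE !negbK => /orP[]/eqP-> /orP[]/eqP->.
- by rewrite eqxx.
- by move=> _ /eqP; rewrite (negPf (huv l)).
- by move=> _ /eqP; rewrite eq_sym (negPf (huv l)).
- by rewrite eqxx.
Qed.

(** This walk stays in [S], so that removing [u] and [v] does not increase any
    distance. *)
Lemma walk_hamming (x y : induced S) : walk (hamming (val x) (val y)) x y.
Proof.
move: {2}(hamming _ _) (erefl (hamming (val x) (val y))) => k.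
elim: k x => [|k IH] x xy.
  rewrite xy; exists [::]; split=> //=.
  by apply: val_inj; apply/eqP; rewrite -hamming_eq0 xy.
have [|i xyi iS] := exists_closer_neighbour (valP x) (valP y).
  by rewrite -hamming_eq0 xy.
pose z : induced S := exist (fun z => z \in S) _ iS.
have zy : hamming (val x) (val y) = (hamming (val z) (val y)).+1 by apply: hamming_flip.
have [|p [zp lp sp]] := IH z; first by move: zy; rewrite xy => -[].
rewrite zy; exists (z :: p); split=> //=; last by rewrite sp.
by rewrite zp andbT; apply: adj_flip.
Qed.

Lemma isometric_two_antipodes_removed : isometric S.
Proof.
move=> x y k; have w := walk_hamming x y.
apply: iff_trans (is_dist_minimal _ w _) (iff_sym (is_dist_minimal _ (walk_val w) _)).
  by move=> j /walk_val; apply: hamming_walk.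
by move=> j; apply: hamming_walk.
Qed.

End TwoAntipodesRemoved.

(** * Subsets as hypercube vertices *)

Section Isomorphism.
Variables (d : nat) (hd : (2 <= d)%N) (u v : hypercube d.+1).
Hypothesis huv : antipodal u v.

Let V : {set 'I_d.-1.+1} := [set ord0; ord_max].
Notation skel := (skeleton (wythoffian (alpha_complex hd) V)^d).
Let S : {set hypercube d.+1} := ~: [set u; v].

(** Translating by [u] reduces the removal of an arbitrary antipodal pair to that
    of the empty and the full set. *)
Definition shifted (A : {set 'I_d.+1}) : hypercube d.+1 := [ffun i => u i (+) (i \in A)].

Lemma shifted_in A : (shifted A \in S) = (A != set0) && (A != setT).
Proof.
rewrite !inE negb_or; congr (~~ _ && ~~ _).
  apply/eqP/eqP => [/ffunP Au|->].
    by apply/setP => i; have := Au i; rewrite ffunE inE; case: (u i); case: (i \in A).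
  by apply/ffunP => i; rewrite ffunE inE addbF.
apply/eqP/eqP => [/ffunP Av|->].
  apply/setP => i; have := Av i; have := huv i; rewrite ffunE inE.
  by case: (u i); case: (v i); case: (i \in A).
by apply/ffunP => i; have := huv i; rewrite ffunE inE; case: (u i); case: (v i).
Qed.

Lemma shifted_adj A B : adj (shifted A) (shifted B) = (#|(A :\: B) :|: (B :\: A)| == 1%N).
Proof.
rewrite /= /hypercube_adj; congr (_ == _); apply: eq_card => i; rewrite !inE !ffunE.
by case: (u i); case: (i \in A); case: (i \in B).
Qed.

Lemma shifted_vertex_in (x : skel) : shifted (vertex_set x) \in S.
Proof. by rewrite shifted_in; apply: lower_proper. Qed.

Lemma skeleton_isomorphic : isomorphic skel (induced S).
Proof.
pose f (x : skel) : induced S := exist (fun s => s \in S) _ (shifted_vertex_in x).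
pose A (s : hypercube d.+1) : {set 'I_d.+1} := [set i | s i != u i].
have AK s : shifted (A s) = s.
  by apply/ffunP => i; rewrite ffunE inE; case: (s i); case: (u i).
have fK (x : skel) : A (val (f x)) = vertex_set x.
  by apply/setP => i; rewrite inE ffunE; case: (u i); case: (i \in _).
have fonto (s : induced S) : exists x : skel, vertex_set x == A (val s) :> {set 'I_d.+1}.
  have := valP s; rewrite -{1}[val s]AK shifted_in => /andP[A0 AT].
  by have [x xA] := vertex_set_onto hd A0 AT; exists x; apply/eqP.
exists f; split; last by move=> x y; rewrite skeleton_adjE -shifted_adj.
(* Vertices of the skeleton carry a flag and two proofs, so the inverse is chosen
   from surjectivity. *)
exists (fun s => xchoose (fonto s)) => [x|s].
  by apply: vertex_set_inj; rewrite (eqP (xchooseP (fonto (f x)))) fK.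
by apply: val_inj; rewrite /= (eqP (xchooseP (fonto s))) AK.
Qed.

End Isomorphism.

Theorem proposition3 (d : nat) (hd : (2 <= d)%N) (u v : hypercube d.+1)
    (huv : antipodal u v) :
  let V : {set 'I_d.-1.+1} := [set ord0; ord_max] in
  let S : {set hypercube d.+1} := ~: [set u; v] in
  isomorphic (skeleton (wythoffian (alpha_complex hd) V)^d) (induced S) /\
  isometric S.
Proof.
split; first exact: skeleton_isomorphic.
exact: isometric_two_antipodes_removed.
Qed.
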